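(* Let $P_n$ be the path on $n$ vertices, where $n\geq 3$, and let $k,t$ be positive integers. If $k \leq 1 + \lfloor \frac{n}{2} \rfloor$, then $\rho'(P_n^k) = 1$. Moreover, if $t \leq \lfloor \frac{n}{2} \rfloor$, then $\rho(P_n^t) = 1$.
   Context: $G^k$ denotes the $k$-th Cartesian power of $G$: $G^1=G$ and $G^k=G\square G^{k-1}$, where $\square$ is the Cartesian product of graphs. A vertex (or edge) coloring of a graph is distinguishing if no automorphism other than the identity preserves it. $D(G)$ (resp. $D'(G)$) is the least number of colors in a distinguishing vertex (resp. edge) coloring of $G$. When $D(G)=2$, the cost of distinguishing $\rho(G)$ is the minimum number of vertices in the smaller color class over all distinguishing vertex colorings of $G$ with two colors. When $D'(G)=2$, the cost of edge-distinguishing $\rho'(G)$ is the minimum number of edges in the smaller color class over all distinguishing edge colorings of $G$ with two colors. *)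

(* Defs.v *)
From HB Require Import structures.
From mathcomp Require Import all_boot all_fingroup.

Set Implicit Arguments.
Unset Strict Implicit.
Unset Printing Implicit Defensive.

Record sgraph := SGraph {
  vertex :> finType;
  adj : rel vertex;
  adj_sym : symmetric adj;
  adj_irr : irreflexive adj
}.

Section PathGraph.
Variable n : nat.

Definition path_adj : rel 'I_n := fun i j => (i.+1 == j) || (j.+1 == i).

Lemma path_adj_sym : symmetric path_adj.
Proof. by move=> i j; rewrite /path_adj orbC. Qed.

Lemma path_adj_irr : irreflexive path_adj.
Proof. by move=> i; rewrite /path_adj orbb eqn_leq ltnn. Qed.

Definition path_graph := SGraph path_adj_sym path_adj_irr.
End PathGraph.

Section CartesianProduct.
Variables G H : sgraph.

Definition cart_adj : rel (G * H)%type := fun x y =>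
  (x.1 == y.1) && adj x.2 y.2 || (x.2 == y.2) && adj x.1 y.1.

Lemma cart_adj_sym : symmetric cart_adj.
Proof.
move=> x y; rewrite /cart_adj [x.1 == _]eq_sym [x.2 == _]eq_sym.
by rewrite [adj x.1 _]adj_sym [adj x.2 _]adj_sym.
Qed.

Lemma cart_adj_irr : irreflexive cart_adj.
Proof. by move=> x; rewrite /cart_adj !adj_irr !andbF. Qed.

Definition cart_prod := SGraph cart_adj_sym cart_adj_irr.
End CartesianProduct.

Definition K1 : sgraph :=
  @SGraph unit (fun _ _ => false) (fun _ _ => erefl) (fun _ => erefl).

Fixpoint cart_pow (G : sgraph) (k : nat) : sgraph :=
  match k with
  | 0 => K1
  | 1 => G
  | k'.+1 => cart_prod G (cart_pow G k')
  end.

Section Distinguishing.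
Variable G : sgraph.

Definition is_aut (phi : {perm G}) : Prop :=
  forall x y : G, adj (phi x) (phi y) = adj x y.

Definition edges : {set {set G}} :=
  [set [set p.1; p.2] | p : G * G & adj p.1 p.2].

Definition edge : finType := {e : {set G} | e \in edges}.

Definition dist_vcoloring d (c : {ffun G -> 'I_d}) : Prop :=
  forall phi : {perm G},
    is_aut phi -> (forall x, c (phi x) = c x) -> phi = 1%g.

(* The image of an edge under an automorphism is an edge, so [f] below ranges
   over exactly one edge for each [e]. *)
Definition dist_ecoloring d (c : {ffun edge -> 'I_d}) : Prop :=
  forall phi : {perm G},
    is_aut phi ->
    (forall e f : edge, val f = phi @: val e -> c f = c e) -> phi = 1%g.

End Distinguishing.

Definition is_least (P : nat -> Prop) (m : nat) : Prop :=
  P m /\ forall m', P m' -> m <= m'.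

Definition smaller_class (T : finType) (c : {ffun T -> 'I_2}) : nat :=
  minn #|[set x | c x == ord0]| #|[set x | c x == ord_max]|.

(* D, D', rho and rho' are relations, with [_ G m] meaning "is defined at G and
   equals m", because they may be undefined: D'(K_2) does not exist, and the costs
   make sense only when the corresponding number of colors is 2. *)

Definition dist_number (G : sgraph) (d : nat) : Prop :=
  is_least (fun d => exists c : {ffun G -> 'I_d}, dist_vcoloring c) d.

Definition dist_index (G : sgraph) (d : nat) : Prop :=
  is_least (fun d => exists c : {ffun edge G -> 'I_d}, dist_ecoloring c) d.

Definition dist_cost (G : sgraph) (r : nat) : Prop :=
  dist_number G 2 /\
  is_least (fun m => exists2 c : {ffun G -> 'I_2},
                       dist_vcoloring c & smaller_class c = m) r.

Definition edge_dist_cost (G : sgraph) (r : nat) : Prop :=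
  dist_index G 2 /\
  is_least (fun m => exists2 c : {ffun edge G -> 'I_2},
                       dist_ecoloring c & smaller_class c = m) r.

(* Main.v *)
Require Import Defs.
From mathcomp Require Import all_boot.
From mathcomp Require Import all_fingroup zify.

(** The automorphisms of [P_n^k] preserve the l1 metric [dist], hence also the
    set of corners (the points having an antipode at maximal distance). If such
    an automorphism moreover preserves a separable weight
    [x |-> \sum_i g i (x_i)] whose increments [g i (n - 1) - g i 0] are positive
    and pairwise distinct, it fixes the origin (the lightest corner), then each
    corner [(n - 1) e_i] (the corners at distance [n - 1] from the origin, told
    apart by their weights), and therefore every point, as the distances to
    these [k + 1] corners determine the coordinates. The weight is the distance
    to the vertex [(0, 1, ..., t - 1)], resp. the sum of the distances to the two
    ends of the edge joining [(0, 0, 1, ..., k - 2)] to [(1, 0, 1, ..., k - 2)]. *)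

Set Implicit Arguments.
Unset Strict Implicit.
Unset Printing Implicit Defensive.

(** * Coordinates on Cartesian powers *)

Section Coordinates.
Variables (G : sgraph) (x0 : G).

(* [x0] is a junk value for the coordinates of index at least [k]. *)
Fixpoint coord k : cart_pow G k -> nat -> G :=
  match k return cart_pow G k -> nat -> G with
  | 0 => fun _ _ => x0
  | k1.+1 => match k1 return (cart_pow G k1 -> nat -> G) ->
                             cart_pow G k1.+1 -> nat -> G with
    | 0 => fun _ x _ => x
    | k2.+1 => fun coord1 x i => if i is j.+1 then coord1 x.2 j else x.1
    end (@coord k1)
  end.

(** As in [coord], the inner match follows [cart_pow], where the exponent 1 is a case of its own. *)
Fixpoint of_coord k (f : nat -> G) : cart_pow G k :=
  match k return cart_pow G k with
  | 0 => tt
  | k1.+1 => match k1 return cart_pow G k1 -> cart_pow G k1.+1 with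
    | 0 => fun _ => f 0
    | k2.+1 => fun y => (f 0, y)
    end (of_coord k1 (fun i => f i.+1))
  end.

Lemma of_coordK k f i : i < k -> coord (of_coord k f) i = f i.
Proof.
elim: k f i => // -[|k] IHk f [|i] //= lt_i.
exact: (IHk (fun i => f i.+1)).
Qed.

Lemma coord_inj k (x y : cart_pow G k) :
  (forall i, i < k -> coord x i = coord y i) -> x = y.
Proof.
elim: k x y => [|[|k] IHk]; first by move=> [] [].
  by move=> x y /(_ 0 isT).
move=> [x1 x2] [y1 y2] Exy; congr pair; first exact: (Exy 0 isT).
by apply: IHk => i lt_i; exact: (Exy i.+1 lt_i).
Qed.

Lemma cart_pow_adjP k (x y : cart_pow G k) :
  adj x y <-> exists i, [/\ i < k, adj (coord x i) (coord y i) &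
    forall j, j < k -> j != i -> coord x j = coord y j].
Proof.
elim: k x y => [|[|k] IHk].
- by move=> x y; split=> // -[i []].
- move=> x y; split=> [xy | [i [] //]].
  by exists 0; split=> // -[].
move=> [x1 x2] [y1 y2]; split.
  case/orP=> /= /andP[/eqP E xy].
    have /IHk[i [lt_i xyi Exy]] := xy.
    by exists i.+1; split=> // -[|j] //= lt_j ne_ji; exact: Exy.
  by exists 0; split=> // -[|j] //= _ _; rewrite E.
case=> -[|i] [lt_i /= xy Exy]; apply/orP => /=.
  right; rewrite xy andbT; apply/eqP; apply: (@coord_inj k.+1) => j lt_j.
  exact: (Exy j.+1 lt_j).
left; apply/andP; split; first by apply/eqP; exact: (Exy 0 isT).
apply/IHk; exists i; split=> // j lt_j ne_ji.
exact: (Exy j.+1 lt_j).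
Qed.

End Coordinates.

Lemma is_autV (G : sgraph) (phi : {perm G}) : is_aut phi -> is_aut phi^-1%g.
Proof. by move=> aut x y; rewrite -aut !permKV. Qed.

Lemma sum_ordD1 k (F : 'I_k -> nat) i (lt_i : i < k) :
  \sum_(j < k) F j = F (Ordinal lt_i) + \sum_(j < k | j != i :> nat) F j.
Proof. by rewrite (bigD1 (Ordinal lt_i)). Qed.

Section PathPower.
Variables n k : nat.

(* The path has [n.+1] vertices, so that its ends are [0] and [n]. *)
Local Notation P := (path_graph n.+1).
Local Notation V := (cart_pow P k).

Definition pcoord (x : V) (i : nat) : nat := (coord (ord0 : P) x i : 'I_n.+1).
Definition vertex_at (f : nat -> nat) : V :=
  of_coord k (fun i => inord (f i) : P).

Lemma pcoord_le x i : pcoord x i <= n.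
Proof. exact: leq_ord. Qed.

Lemma pcoord_inj x y : (forall i, i < k -> pcoord x i = pcoord y i) -> x = y.
Proof.
by move=> E; apply: (@coord_inj _ (ord0 : P)) => i /E Ei; apply: val_inj.
Qed.

Lemma vertex_atK f i : i < k -> f i <= n -> pcoord (vertex_at f) i = f i.
Proof. by move=> lt_i le_f; rewrite /pcoord of_coordK // inordK. Qed.

Lemma pcoord_adjP (x y : V) :
  adj x y <-> exists i, [/\ i < k,
    (pcoord x i).+1 = pcoord y i \/ (pcoord y i).+1 = pcoord x i &
    forall j, j < k -> j != i -> pcoord x j = pcoord y j].
Proof.
split.
  case/(cart_pow_adjP (ord0 : P)) => i [lt_i xy E]; exists i; split=> //.
    by case/orP: xy => /eqP; [left | right].
  by move=> j lt_j ne_ji; rewrite /pcoord E.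
case=> i [lt_i xy E]; apply/(cart_pow_adjP (ord0 : P)); exists i; split=> //.
  by apply/orP; case: xy => E'; [left | right]; apply/eqP.
by move=> j lt_j ne_ji; apply: val_inj; exact: E.
Qed.

(** * The l1 metric and its invariance under automorphisms *)

Definition ndist (a b : nat) := (a - b) + (b - a).
Definition dist (x y : V) := \sum_(i < k) ndist (pcoord x i) (pcoord y i).

Lemma dist_triangle x y z : dist x z <= dist x y + dist y z.
Proof.
rewrite /dist -big_split /=; apply: leq_sum => i _.
by rewrite /ndist; lia.
Qed.

Lemma dist_eq0 x y : dist x y = 0 -> x = y.
Proof.
move/eqP; rewrite sum_nat_eq0 => /forallP E; apply: pcoord_inj => i lt_i.
by move: (E (Ordinal lt_i)) => /=; rewrite /ndist; lia.
Qed.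

Lemma dist_adj x y : adj x y -> dist x y = 1.
Proof.
case/pcoord_adjP=> i [lt_i xy E]; rewrite /dist (bigD1 (Ordinal lt_i)) //=.
rewrite big1 => [|j ne_ji]; first by rewrite /ndist; lia.
by rewrite E // /ndist; lia.
Qed.

(** Some coordinate differs; moving it one step towards [y] gives [z]. With [dist_adj], this lets
    [dist] serve as the graph distance without introducing walks. *)
Lemma dist_step x y m : dist x y = m.+1 -> exists2 z, adj x z & dist z y = m.
Proof.
move=> Dxy; have /existsP[i ne_i] : [exists i : 'I_k, pcoord x i != pcoord y i].
  apply: contraPT Dxy => /existsPn E.
  rewrite /dist big1 // => i _; move: (E i); rewrite /ndist; lia.
pose f j := if j == i :> nat then
  (if pcoord x i < pcoord y i then (pcoord x i).+1 else (pcoord x i).-1)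
  else pcoord x j.
have fE j : j < k -> pcoord (vertex_at f) j = f j.
  move=> lt_j; apply: vertex_atK => //; rewrite /f.
  by have := (pcoord_le x i, pcoord_le y i, pcoord_le x j) => -[[]];
    do 2?case: ifP; lia.
have fiE : f i = if pcoord x i < pcoord y i
                 then (pcoord x i).+1 else (pcoord x i).-1.
  by rewrite /f eqxx.
have fjE j : j != i :> nat -> f j = pcoord x j by rewrite /f => /negbTE->.
exists (vertex_at f).
  apply/pcoord_adjP; exists i; split=> // [|j lt_j ne_ji].
    by rewrite fE // fiE; move: ne_i; case: ifP; lia.
  by rewrite fE // fjE.
move: Dxy; rewrite /dist (bigD1 i) //= [in X in _ -> X](bigD1 i) //= fE // fiE.
rewrite [in X in _ -> X](eq_bigr (fun j : 'I_k => ndist (pcoord x j) (pcoord y j)))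
  => [|j ne_ji]; last by rewrite fE // fjE.
by move: ne_i; rewrite /ndist; case: ifP; lia.
Qed.

(** Induction along a geodesic: [phi] sends each of its edges to an edge, of length 1, and the
    triangle inequality adds these up. *)
Lemma aut_dist_le (phi : {perm V}) x y :
  is_aut phi -> dist (phi x) (phi y) <= dist x y.
Proof.
move=> aut; move Em: (dist x y) => m; elim: m x Em => [|m IHm] x.
  by move/dist_eq0->; rewrite /dist big1 // => i _; rewrite /ndist subnn.
case/dist_step=> z' zz' /IHm le_m.
apply: leq_trans (dist_triangle _ (phi z') _) _.
by rewrite dist_adj ?aut.
Qed.

Lemma aut_dist (phi : {perm V}) x y :
  is_aut phi -> dist (phi x) (phi y) = dist x y.
Proof.
move=> aut; apply/eqP; rewrite eqn_leq aut_dist_le //=.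
rewrite -{1}[x](permK phi) -{1}[y](permK phi).
exact/aut_dist_le/is_autV.
Qed.

(** The central reflection: a nontrivial automorphism, which rules out constant colorings, and the
    antipodal map on corners. *)
Definition flip (x : V) : V := vertex_at (fun i => n - pcoord x i).

Lemma pcoord_flip x i : i < k -> pcoord (flip x) i = n - pcoord x i.
Proof. by move=> lt_i; rewrite vertex_atK // leq_subr. Qed.

Lemma flipK : involutive flip.
Proof.
move=> x; apply: pcoord_inj => i lt_i; rewrite !pcoord_flip // subKn //.
exact: pcoord_le.
Qed.

Definition flip_perm : {perm V} := perm (inv_inj flipK).

Lemma flip_adj x y : adj x y -> adj (flip x) (flip y).
Proof.
case/pcoord_adjP=> i [lt_i xy E]; apply/pcoord_adjP; exists i; split=> //.
  by rewrite !pcoord_flip //; have := (pcoord_le x i, pcoord_le y i) => -[]; lia.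
by move=> j lt_j ne_ji; rewrite !pcoord_flip // E.
Qed.

Lemma flip_aut : is_aut flip_perm.
Proof.
move=> x y; rewrite !permE; apply/idP/idP; last exact: flip_adj.
by move/flip_adj; rewrite !flipK.
Qed.

Lemma flip_neq1 : 0 < n -> 0 < k -> flip_perm <> 1%g.
Proof.
move=> n_gt0 k_gt0 /permP/(_ (vertex_at (fun=> 0))); rewrite permE perm1.
move/(congr1 (fun x => pcoord x 0)).
by rewrite pcoord_flip // vertex_atK //; lia.
Qed.

(** * Corners of the grid *)

Definition corner (x : V) := forall i, i < k -> pcoord x i = 0 \/ pcoord x i = n.

(** Each of the [k] terms is at most [n], so all of them equal [n], and this happens only between
    the two ends of the path. *)
Lemma dist_antipodal_corner x y : dist x y = k * n -> corner x.
Proof.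
move=> Dxy.
have le_n (i : 'I_k) : true -> ndist (pcoord x i) (pcoord y i) <= n ?= iff
                       (ndist (pcoord x i) (pcoord y i) == n).
  move=> _; split=> //.
  by have := (pcoord_le x i, pcoord_le y i) => -[]; rewrite /ndist; lia.
have [_] := leqif_sum le_n.
rewrite sum_nat_const card_ord -/(dist x y) Dxy eqxx => /esym/forallP E i lt_i.
move: (E (Ordinal lt_i)) (pcoord_le x i) (pcoord_le y i) => /=.
by rewrite /ndist; lia.
Qed.

Lemma aut_corner (phi : {perm V}) x : is_aut phi -> corner x -> corner (phi x).
Proof.
move=> aut cx; apply: (@dist_antipodal_corner _ (phi (flip x))).
rewrite aut_dist // /dist (eq_bigr (fun=> n)) => [|i _].
  by rewrite sum_nat_const card_ord.
rewrite pcoord_flip //; case: (cx i) => // ->; rewrite /ndist; lia.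
Qed.

Definition origin : V := vertex_at (fun=> 0).
Definition axis_corner i : V := vertex_at (fun j => if j == i then n else 0).

Lemma pcoord_origin i : i < k -> pcoord origin i = 0.
Proof. by move=> lt_i; rewrite vertex_atK. Qed.

Lemma pcoord_axis i j : j < k -> pcoord (axis_corner i) j = if j == i then n else 0.
Proof. by move=> lt_j; rewrite vertex_atK //; case: ifP. Qed.

Lemma dist_origin x : dist x origin = \sum_(i < k) pcoord x i.
Proof.
by apply: eq_bigr => i _; rewrite pcoord_origin // /ndist subn0 addn0.
Qed.

(** Only the [i]-th terms differ: [n - pcoord x i] against [pcoord x i]. Hence two distances
    determine this coordinate. *)
Lemma dist_axis x i : i < k ->
  dist x (axis_corner i) + (pcoord x i).*2 = dist x origin + n.
Proof.
move=> lt_i; rewrite dist_origin /dist !(sum_ordD1 _ lt_i) /=.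
rewrite pcoord_axis // eqxx (eq_bigr (fun j : 'I_k => pcoord x j)) => [|j ne_ji].
  by have := pcoord_le x i; rewrite /ndist; lia.
by rewrite pcoord_axis // (negbTE ne_ji) /ndist subn0 addn0.
Qed.

Lemma corner_axis x : 0 < n -> corner x -> dist x origin = n ->
  exists2 i, i < k & x = axis_corner i.
Proof.
move=> n_gt0 cx Dx.
have /existsP[i xi0] : [exists i : 'I_k, pcoord x i != 0].
  apply: contraPT n_gt0 => /existsPn E.
  by rewrite -Dx dist_origin big1 // => i _; apply/eqP; move: (E i); rewrite negbK.
have xi : pcoord x i = n by case: (cx i) xi0 => // ->.
exists i => //; apply: pcoord_inj => j lt_j; rewrite pcoord_axis //.
case: eqP => [-> // | /eqP ne_ji].
(* Coordinate [i] already accounts for the whole sum [n], so the others vanish. *)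
move/eqP: Dx; rewrite dist_origin (bigD1 i) //= xi -[X in _ == X]addn0 eqn_add2l.
rewrite sum_nat_eq0 => /forallP/(_ (Ordinal lt_j)) /implyP xj.
by apply/eqP/xj.
Qed.

(** * Rigidity from a separable weight *)

Section Weight.
Variable g : nat -> nat -> nat.
Hypothesis g_lt : forall i, i < k -> g i 0 < g i n.
(** The equality of the increments [g i n - g i 0] and [g j n - g j 0], free of truncated
    subtraction. *)
Hypothesis g_inj : forall i j, i < k -> j < k ->
  g i n + g j 0 = g j n + g i 0 -> i = j.

Definition weight (x : V) := \sum_(i < k) g i (pcoord x i).

(** At a corner each term of the weight is at least [g i 0], so equal totals force equality term by
    term. *)
Lemma weight_origin_eq x : corner x -> weight x = weight origin -> x = origin.
Proof.
move=> cx Wx; have le_g (i : 'I_k) : true ->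
    g i (pcoord origin i) <= g i (pcoord x i) ?= iff (pcoord x i == 0).
  move=> _; rewrite pcoord_origin //; have lt_g := g_lt (ltn_ord i).
  case: (cx i) => // ->; first exact/leqif_refl.
  split; first exact: ltnW.
  by case: (n =P 0) lt_g => [-> | _]; [rewrite ltnn | move/ltn_eqF].
have [_] := leqif_sum le_g.
rewrite -/(weight x) -/(weight origin) Wx eqxx => /esym/forallP E.
apply: pcoord_inj => i lt_i; rewrite pcoord_origin //.
by apply/eqP; exact: (E (Ordinal lt_i)).
Qed.

Lemma weight_axis i : i < k ->
  weight (axis_corner i) + g i 0 = weight origin + g i n.
Proof.
move=> lt_i; rewrite /weight !(sum_ordD1 _ lt_i) /=.
rewrite pcoord_axis // pcoord_origin // eqxx.
rewrite (eq_bigr (fun j : 'I_k => g j (pcoord origin j))) => [|j ne_ji]; first lia.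
by rewrite pcoord_axis // pcoord_origin // (negbTE ne_ji).
Qed.

Lemma weight_aut_eq1 (phi : {perm V}) :
  is_aut phi -> (forall x, weight (phi x) = weight x) -> phi = 1%g.
Proof.
move=> aut W; case: (posnP n) => [n0 | n_gt0].
  apply/permP=> x; rewrite perm1; apply: pcoord_inj => i _.
  by have := (pcoord_le (phi x) i, pcoord_le x i) => -[]; lia.
have c0 : corner origin by move=> i lt_i; left; exact: pcoord_origin.
have phi0 : phi origin = origin.
  by apply: weight_origin_eq; [exact: aut_corner | exact: W].
have phi_axis i : i < k -> phi (axis_corner i) = axis_corner i.
  move=> lt_i; have ci : corner (axis_corner i).
    by move=> j lt_j; rewrite pcoord_axis //; case: ifP; [right | left].
  have Di : dist (phi (axis_corner i)) origin = n.
    rewrite -{1}phi0 aut_dist //.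
    have := dist_axis (axis_corner i) lt_i; rewrite pcoord_axis // eqxx.
    suff -> : dist (axis_corner i) (axis_corner i) = 0 by lia.
    by apply: big1 => j _; rewrite /ndist subnn.
  have [j lt_j Ej] := corner_axis n_gt0 (aut_corner aut ci) Di.
  rewrite Ej; congr axis_corner; apply: g_inj => //.
  (* Equal weights of the corners [i] and [j] mean equal increments. *)
  have := (W (axis_corner i), weight_axis lt_i, weight_axis lt_j) => -[[]].
  by rewrite Ej; lia.
apply/permP=> x; rewrite perm1; apply: pcoord_inj => i lt_i.
have := (dist_axis (phi x) lt_i, dist_axis x lt_i) => -[].
by rewrite -{1}phi0 -{1}(phi_axis i lt_i) !aut_dist //; lia.
Qed.

End Weight.

End PathPower.

(** * Colorings with a single marked vertex or edge *)

(** [D] is abstract so as to cover both vertex and edge colorings. As no constant coloring is good,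
    at least two colors are needed, and with two colors neither class is empty. *)
Lemma least_two_colors (T : finType) (D : forall d, {ffun T -> 'I_d} -> Prop)
    (x0 : T) :
  (forall d (c : {ffun T -> 'I_d}), D d c -> exists x y, c x != c y) ->
  D 2 [ffun x => if x == x0 then ord_max else ord0] ->
  is_least (fun d => exists c, D d c) 2 /\
  is_least (fun m => exists2 c, D 2 c & smaller_class c = m) 1.
Proof.
move=> nonconst Dx0; split; split.
- by eexists; exact: Dx0.
- move=> d [c /nonconst[x [y]]]; rewrite -val_eqE /=.
  by move: (ltn_ord (c x)) (ltn_ord (c y)); lia.
- exists [ffun x => if x == x0 then ord_max else ord0] => //.
  have [x [y]] := nonconst _ _ Dx0; rewrite !ffunE => ne_xy.
  rewrite /smaller_class.
  have -> : [set x | [ffun x => if x == x0 then ord_max else ord0] x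
                     == ord_max :> 'I_2] = [set x0].
    by apply/setP=> z; rewrite !inE ffunE; case: (z == x0).
  rewrite cards1; apply/minn_idPr/card_gt0P.
  (* The marked coloring is not constant either, so the class of [ord0] is nonempty. *)
  have [z ne_z] : exists z, z != x0.
    have [xx0 | ne_x] := eqVneq x x0; last by exists x.
    by exists y; apply: contraNneq ne_xy => ->; rewrite xx0.
  by exists z; rewrite inE ffunE (negbTE ne_z).
- move=> m [c /nonconst[x [y ne_xy]] <-]; rewrite leq_min.
  have hit (i : 'I_2) : 0 < #|[set x | c x == i]|.
    apply/card_gt0P; have [|ne_x] := eqVneq (c x) i; first by exists x; rewrite inE; apply/eqP.
    exists y; rewrite inE; move: ne_xy ne_x; rewrite -!val_eqE /=.
    by move: (ltn_ord (c x)) (ltn_ord (c y)) (ltn_ord i); lia.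
  by rewrite !hit.
Qed.

Lemma nonconst_colors (T : finType) d (c : {ffun T -> 'I_d}) :
  ~ (forall x y, c x = c y) -> exists x y, c x != c y.
Proof.
move=> nconst; have [/existsP[x /existsP[y]]|] := boolP [exists x, exists y, c x != c y].
  by exists x, y.
move/existsPn => E; case: nconst => x y; apply/eqP.
by move/existsPn: (E x) => /(_ y); rewrite negbK.
Qed.

(** The increments are [n - 2 * i], which are distinct; they are positive since
    [2 * i <= 2 * t - 2 < n]. *)
Lemma path_pow_dist_cost n t : 0 < n -> 0 < t -> t <= n.+1./2 ->
  dist_cost (cart_pow (path_graph n.+1) t) 1.
Proof.
move=> n_gt0 t_gt0 le_t; pose v : cart_pow (path_graph n.+1) t := vertex_at n t id.
have vE i : i < t -> pcoord v i = i by move=> lt_i; rewrite vertex_atK //; lia.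
apply: (@least_two_colors _ (fun d c => @dist_vcoloring _ d c) v) => [d c Dc | phi aut c_phi].
  apply: nonconst_colors => c_const.
  by apply: (flip_neq1 n_gt0 t_gt0); apply: Dc => //; exact: flip_aut.
(* [v] is the only vertex of its color. *)
have phi_v : phi v = v.
  by move: (c_phi v); rewrite !ffunE eqxx; case: eqP.
apply: (@weight_aut_eq1 _ _ (fun i a => ndist a i) _ _ _ aut) => [i lt_i|i j lt_i lt_j|x].
- by rewrite /ndist; lia.
- by rewrite /ndist; lia.
have WE y : weight (fun i a => ndist a i) y = dist y v.
  by apply: eq_bigr => i _; rewrite vE.
by rewrite !WE -{1}phi_v aut_dist.
Qed.

(** The increment is [2 * n - 2] for coordinate 0 and [2 * n - 4 * (i - 1)] for [i > 0]. These are
    distinct, the first differing from the others modulo 4, and positive by the bounds on [n] and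
    [k]. *)
Lemma path_pow_edge_dist_cost n k : 1 < n -> 0 < k -> k <= 1 + n.+1./2 ->
  edge_dist_cost (cart_pow (path_graph n.+1) k) 1.
Proof.
move=> n_gt1 k_gt0 le_k; set G := cart_pow _ k.
pose fw i := if i is j.+1 then j else 1.
(* [predn] sends 0 to 0, so [u] starts with two zeros and differs from [w] only in coordinate 0. *)
pose u : G := vertex_at n k predn; pose w : G := vertex_at n k fw.
have uE i : i < k -> pcoord u i = i.-1.
  by move=> lt_i; rewrite vertex_atK //; lia.
have wE i : i < k -> pcoord w i = fw i.
  by move=> lt_i; rewrite vertex_atK //; case: i lt_i => /=; lia.
have uw : adj u w.
  apply/pcoord_adjP; exists 0; split=> // [|[|j] lt_j //].
    by left; rewrite uE ?wE.
  by rewrite uE ?wE.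
have e0P : [set u; w] \in edges G.
  by apply/imsetP; exists (u, w); rewrite ?inE.
pose e0 : edge G := exist _ [set u; w] e0P.
apply: (@least_two_colors _ (fun d c => @dist_ecoloring _ d c) e0) => [d c Dc | phi aut c_phi].
  apply: nonconst_colors => c_const.
  by apply: (flip_neq1 (ltnW n_gt1) k_gt0); apply: Dc => //; exact: flip_aut.
have phi_e0 : phi @: [set u; w] = [set u; w].
  have fP : phi @: [set u; w] \in edges G.
    apply/imsetP; exists (phi u, phi w); first by rewrite inE /= aut.
    by rewrite imsetU1 imset_set1.
  have := c_phi e0 (exist _ (phi @: [set u; w]) fP) erefl; rewrite !ffunE eqxx.
  by case: eqP => // /(congr1 val).
pose g i a := ndist a i.-1 + ndist a (fw i).
apply: (@weight_aut_eq1 _ _ g _ _ _ aut) => [i lt_i|i j lt_i lt_j|x].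
- by rewrite /g /ndist; case: i lt_i => [|i] /=; lia.
- by rewrite /g /ndist; case: i lt_i => [|i]; case: j lt_j => [|j] /=; lia.
(* A sum over the set of ends is unaffected if [phi] swaps them. *)
have WE y : weight g y = \sum_(z in [set u; w]) dist y z.
  rewrite big_setU1 ?big_set1 /=; last first.
    by rewrite inE; apply: contraTneq uw => ->; rewrite adj_irr.
  by rewrite -big_split; apply: eq_bigr => i _; rewrite uE ?wE.
rewrite !WE -{1}phi_e0 big_imset /=; last by move=> ? ? _ _; exact: perm_inj.
by apply: eq_bigr => z _; rewrite aut_dist.
Qed.

Theorem theorem5p1 (n k t : nat) (hn : 3 <= n) (hk : 0 < k) (ht : 0 < t) :
  (k <= 1 + n./2 -> edge_dist_cost (cart_pow (path_graph n) k) 1) /\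
  (t <= n./2 -> dist_cost (cart_pow (path_graph n) t) 1).
Proof.
case: n hn => // n hn; split.
  exact: path_pow_edge_dist_cost.
by apply: path_pow_dist_cost; first exact: ltnW.
Qed.
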